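(* Let $\alpha$ be a real parameter, and assume $g(0)=0$. The solution of the initial- and boundary-value problem $$ \begin{cases} u_t+\alpha u_x-\gamma u_{xxt}=f, & x\ge 0,\ t\ge 0,\\ u(x,0)=u_0(x), & x\ge 0,\\ u(0,t)=g(t), & t\ge 0, \end{cases} $$ with $\gamma=0$ and $f\equiv 0$ (that is, with the equation $u_t+\alpha u_x=0$) is given by $$ u(x,t)=\begin{cases} u_0(x-\alpha t), & \text{if } x\ge \alpha t,\\ g\left(t-\dfrac{x}{\alpha}\right), & \text{if } x<\alpha t. \end{cases} $$
   Context: The problem is posed in the quarter plane $\{(x,t): x\ge 0,\ t\ge 0\}$. The function $u=u(x,t)$ is the unknown, $u_0$ is the initial data, $g$ is the boundary data, and $f=f(x,t)$ is the forcing term. Subscripts on $u$ denote partial derivatives. *)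

(* Defs.v *)
From Stdlib Require Import Reals.
From Coquelicot Require Import Coquelicot.
Open Scope R_scope.

Definition half_line (x : R) : Prop := 0 <= x.

Definition quarter_plane (p : R * R) : Prop := 0 <= fst p /\ 0 <= snd p.

(* [is_derive] with the limit restricted to the half-line: the right derivative
   when [x = 0], the usual derivative when [0 < x]. *)
Definition is_derive_half_line (f : R -> R) (x l : R) : Prop :=
  filterdiff f (within half_line (locally x)) (fun h : R => scal h l).

(* [u] is differentiable at [(x, t)] relative to the closed quarter plane, with
   partial derivatives [ux] and [ut] (one-sided where [(x, t)] lies on an axis). *)
Definition is_partials (u : R -> R -> R) (x t ux ut : R) : Prop :=
  filterdiff (fun p : R * R => u (fst p) (snd p))
    (within quarter_plane (locally (x, t)))
    (fun h : R * R => ux * fst h + ut * snd h).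

(* Classical solutions.  No continuity of the partial derivatives is required,
   so C^1 solutions are a special case. *)
Record transport_solution (alpha : R) (u0 g : R -> R) (u : R -> R -> R) : Prop :=
  { transport_equation : forall x t, 0 <= x -> 0 <= t ->
      exists ux ut, is_partials u x t ux ut /\ ut + alpha * ux = 0;
    transport_initial : forall x, 0 <= x -> u x 0 = u0 x;
    transport_boundary : forall t, 0 <= t -> u 0 t = g t }.

Definition transport_formula (alpha : R) (u0 g : R -> R) (x t : R) : R :=
  if Rle_dec (alpha * t) x then u0 (x - alpha * t) else g (t - x / alpha).

(* Conditions on the data that the existence of a classical solution forces.
   When [0 < alpha], the first-order condition is the equation read at the corner.
   When [alpha <= 0], characteristics run from the initial line to the boundary
   (or along it), so [u0] determines the boundary values. *)
Definition admissible_data (alpha : R) (u0 g : R -> R) : Prop :=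
  (forall x, 0 <= x -> exists l, is_derive_half_line u0 x l) /\
  (forall t, 0 <= t -> exists l, is_derive_half_line g t l) /\
  (0 < alpha ->
     u0 0 = g 0 /\
     exists a b, is_derive_half_line u0 0 a /\ is_derive_half_line g 0 b /\
                 b + alpha * a = 0) /\
  (alpha <= 0 -> forall t, 0 <= t -> g t = u0 (- alpha * t)).

(* Main.v *)
(** Along a line [s |-> (x + alpha s, t + s)] a solution has derivative
    [alpha u_x + u_t = 0], hence is constant: following the line backwards from
    [(x, t)] until it leaves the quarter plane reads off [u0] or [g].
    Conversely the formula is a function of one linear form on either side of
    [x = alpha t]; on that line the two one-sided differentials [a (dx - alpha dt)]
    and [b (dt - dx / alpha)] coincide because [b + alpha a = 0]. *)

Require Import Defs.
From Stdlib Require Import Reals Lra.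
From Coquelicot Require Import Coquelicot.
Open Scope R_scope.

(** * Relative differentials as epsilon-delta estimates *)

(** [filterdiff] quantifies over all limits of its filter. Since [x] lies in [D], the restricted
    filter is proper, so limits are unique and [x] is the only base point to consider. *)
Lemma is_filter_lim_within {V : NormedModule R_AbsRing} (D : V -> Prop) (x y : V) :
  D x -> is_filter_lim (within D (locally x)) y -> x = y.
Proof.
  intros Dx Hy.
  assert (PF : ProperFilter' (within D (locally x))).
  { constructor.
    - intros H. exact (locally_singleton _ _ H Dx).
    - apply within_filter, locally_filter. }
  apply (is_filter_lim_unique (F := within D (locally x))); trivial.
  intros P HP. unfold within. revert HP. apply filter_imp. auto.
Qed.

Lemma filterdiff_within {V W : NormedModule R_AbsRing} (f l : V -> W)
    (D : V -> Prop) (x : V) :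
  D x -> is_linear l ->
  (filterdiff f (within D (locally x)) l <->
   forall eps : posreal, locally x (fun y => D y ->
     norm (minus (minus (f y) (f x)) (l (minus y x))) <= eps * norm (minus y x))).
Proof.
  intros Dx Hl; split.
  - intros [_ H] eps. apply (H x).
    intros P HP. unfold within. revert HP. apply filter_imp. auto.
  - intros H. split; trivial.
    intros y Hy eps. rewrite <- (is_filter_lim_within D x y Dx Hy). apply H.
Qed.

Lemma is_derive_half_line_eps (f : R -> R) (x l : R) :
  0 <= x -> is_derive_half_line f x l ->
  forall eps, 0 < eps -> exists d, 0 < d /\ forall y, 0 <= y -> Rabs (y - x) < d ->
    Rabs (f y - f x - l * (y - x)) <= eps * Rabs (y - x).
Proof.
  intros Hx H eps Heps.
  unfold is_derive_half_line in H.
  rewrite filterdiff_within in H; [ | exact Hx | exact (is_linear_scal_l (V := R_NormedModule) l) ].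
  destruct (H (mkposreal eps Heps)) as [d Hd].
  exists d; split; [ apply cond_pos | ].
  intros y Hy Hyd. rewrite (Rmult_comm l).
  exact (Hd y Hyd Hy).
Qed.

(** The norm on pairs is Euclidean; comparing it with the sum of absolute values makes later
    estimates linear in each increment. *)
Lemma norm_pair_bounds (a b : R) :
  norm (a, b) <= Rabs a + Rabs b /\ Rabs a + Rabs b <= 2 * norm (a, b).
Proof.
  split.
  - unfold norm; simpl; unfold prod_norm, norm; simpl; unfold abs; simpl.
    pose proof (Rabs_pos a). pose proof (Rabs_pos b).
    apply Rsqr_incr_0; [ | apply sqrt_pos | lra ].
    rewrite Rsqr_sqrt; unfold Rsqr; nra.
  - destruct (norm_prod a b) as [H _].
    assert (Ha : Rabs a <= norm (a, b)) by (eapply Rle_trans; [ apply Rmax_l | exact H ]).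
    assert (Hb : Rabs b <= norm (a, b)) by (eapply Rle_trans; [ apply Rmax_r | exact H ]).
    lra.
Qed.

Lemma is_linear_pair (a b : R) : is_linear (fun h : R * R => a * fst h + b * snd h).
Proof.
  constructor.
  - intros [x1 x2] [y1 y2]. unfold plus; simpl; unfold plus; simpl; ring.
  - intros k [x1 x2]. unfold scal; simpl; unfold scal; simpl; unfold mult; simpl; ring.
  - exists (Rabs a + Rabs b + 1).
    pose proof (Rabs_pos a). pose proof (Rabs_pos b).
    split; [ lra | ].
    intros [x1 x2]. destruct (norm_prod x1 x2) as [H' _].
    assert (H1 : Rabs x1 <= norm (x1, x2)) by (eapply Rle_trans; [ apply Rmax_l | exact H' ]).
    assert (H2 : Rabs x2 <= norm (x1, x2)) by (eapply Rle_trans; [ apply Rmax_r | exact H' ]).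
    pose proof (Rabs_pos x1).
    change (Rabs (a * x1 + b * x2) <= (Rabs a + Rabs b + 1) * norm (x1, x2)).
    eapply Rle_trans; [ apply Rabs_triang | ].
    rewrite !Rabs_mult. nra.
Qed.

Lemma is_partials_eps (u : R -> R -> R) (x t ux ut : R) :
  0 <= x -> 0 <= t ->
  (is_partials u x t ux ut <->
   forall eps, 0 < eps -> exists d, 0 < d /\ forall y s, 0 <= y -> 0 <= s ->
     Rabs (y - x) < d -> Rabs (s - t) < d ->
     Rabs (u y s - u x t - (ux * (y - x) + ut * (s - t)))
       <= eps * (Rabs (y - x) + Rabs (s - t))).
Proof.
  intros Hx Ht. unfold is_partials.
  rewrite filterdiff_within; [ | split; assumption | apply is_linear_pair ].
  split; intros H.
  - intros eps Heps.
    destruct (H (mkposreal eps Heps)) as [d Hd].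
    exists d; split; [ apply cond_pos | ].
    intros y s Hy Hs Hyd Hsd.
    eapply Rle_trans; [ exact (Hd (y, s) (conj Hyd Hsd) (conj Hy Hs)) | ].
    apply Rmult_le_compat_l; [ apply Rlt_le, Heps | ].
    apply (norm_pair_bounds (y - x) (s - t)).
  - intros eps.
    (* Halving [eps] absorbs the factor 2 in the norm comparison. *)
    destruct (H (eps / 2)) as [d [Hd0 Hd]]; [ apply is_pos_div_2 | ].
    exists (mkposreal d Hd0).
    intros [y s] [Hyd Hsd] [Hy Hs].
    eapply Rle_trans; [ exact (Hd y s Hy Hs Hyd Hsd) | ].
    change (eps / 2 * (Rabs (y - x) + Rabs (s - t)) <= eps * norm (y - x, s - t)).
    destruct (norm_pair_bounds (y - x) (s - t)) as [_ Hn].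
    pose proof (cond_pos eps). nra.
Qed.

(** * Constancy along characteristics and uniqueness *)

(** Mean value theorem with derivative 0. The estimate is only asked within [[a, b]] because a
    characteristic may leave the quarter plane at its endpoints. *)
Lemma constant_of_zero_derivative_within (phi : R -> R) (a b : R) :
  a <= b ->
  (forall s, a <= s <= b -> forall eps, 0 < eps -> exists d, 0 < d /\
     forall r, a <= r <= b -> Rabs (r - s) < d ->
       Rabs (phi r - phi s) <= eps * Rabs (r - s)) ->
  phi a = phi b.
Proof.
  intros [Hab | ->] H; [ | reflexivity ].
  (* Clamping the argument turns one-sided continuity at [a] and [b] into continuity. *)
  pose (clamp := fun s => Rmax a (Rmin b s)).
  assert (Hclamp : forall s, a <= clamp s <= b).
  { intros s; unfold clamp, Rmax, Rmin.
    destruct (Rle_dec b s); destruct Rle_dec; lra. }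
  assert (Hid : forall s, a <= s <= b -> clamp s = s).
  { intros s Hs; unfold clamp, Rmax, Rmin.
    destruct (Rle_dec b s); destruct Rle_dec; lra. }
  assert (Hlip : forall r s, Rabs (clamp r - clamp s) <= Rabs (r - s)).
  { intros r s; unfold clamp, Rmax, Rmin, Rabs.
    destruct (Rle_dec b s); destruct (Rle_dec b r);
      repeat destruct Rle_dec; repeat destruct Rcase_abs; lra. }
  assert (Hloc : forall s, a <= s <= b -> forall eps, 0 < eps -> exists d, 0 < d /\
    forall r, Rabs (r - s) < d ->
      Rabs (phi (clamp r) - phi (clamp s)) <= eps * Rabs (r - s)).
  { intros s Hs eps Heps. destruct (H s Hs eps Heps) as [d [Hd0 Hd]].
    exists d; split; trivial. intros r Hr.
    pose proof (Hlip r s) as Hl. rewrite (Hid s Hs) in *.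
    eapply Rle_trans; [ apply Hd; [ apply Hclamp | lra ] | ].
    apply Rmult_le_compat_l; lra. }
  destruct (MVT_gen (fun s => phi (clamp s)) a b (fun _ => 0)) as [c [_ Hc]].
  - rewrite Rmin_left, Rmax_right by lra. intros s Hs.
    split; [ exact (is_linear_scal_l (V := R_NormedModule) 0) | ].
    intros s' Hs'. rewrite <- (is_filter_lim_locally_unique _ _ Hs').
    intros eps. destruct (Hloc s ltac:(lra) eps (cond_pos eps)) as [d [Hd0 Hd]].
    exists (mkposreal d Hd0). intros r Hr.
    eapply Rle_trans; [ right | exact (Hd r Hr) ].
    change (Rabs (phi (clamp r) - phi (clamp s) - (r - s) * 0)
            = Rabs (phi (clamp r) - phi (clamp s))).
    f_equal; ring.
  - rewrite Rmin_left, Rmax_right by lra. intros s Hs eps Heps.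
    (* The derivative estimate with constant 1 already gives continuity. *)
    destruct (Hloc s Hs 1 Rlt_0_1) as [d [Hd0 Hd]].
    exists (Rmin d eps); split; [ now apply Rmin_pos | ].
    intros r [_ Hr]. simpl in Hr |- *. unfold Rdist in *.
    pose proof (Rmin_l d eps). pose proof (Rmin_r d eps).
    specialize (Hd r ltac:(lra)). lra.
  - rewrite !Hid in Hc by lra. lra.
Qed.

Lemma transport_constant_on_characteristics (alpha : R) (u0 g : R -> R)
    (u : R -> R -> R) (x t s : R) :
  transport_solution alpha u0 g u ->
  0 <= x -> 0 <= t -> 0 <= s -> 0 <= x + alpha * s ->
  u x t = u (x + alpha * s) (t + s).
Proof.
  intros [Heq _ _] Hx Ht Hs Hxs.
  (* The quarter plane is convex, so the segment stays in it once both ends do. *)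
  assert (Hpath : forall r, 0 <= r <= s -> 0 <= x + alpha * r).
  { intros r Hr. destruct (Rle_dec 0 alpha); nra. }
  assert (Hphi : u (x + alpha * 0) (t + 0) = u (x + alpha * s) (t + s)).
  2:{ now rewrite Rmult_0_r, !Rplus_0_r in Hphi. }
  apply (constant_of_zero_derivative_within (fun r => u (x + alpha * r) (t + r)));
    trivial.
  intros r Hr eps Heps.
  destruct (Heq (x + alpha * r) (t + r)) as [ux [ut [Hd H0]]]; [ now apply Hpath | lra | ].
  pose proof (Rabs_pos alpha) as Ha.
  rewrite is_partials_eps in Hd; [ | now apply Hpath | lra ].
  (* A parameter increment [h] moves the point by [(1 + Rabs alpha) * Rabs h] in the sum norm, hence
     this scaling of [eps] and of the radius. *)
  destruct (Hd (eps / (1 + Rabs alpha))) as [d [Hd0 Hd']];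
    [ apply Rdiv_lt_0_compat; lra | ].
  exists (d / (1 + Rabs alpha)); split; [ apply Rdiv_lt_0_compat; lra | ].
  intros q Hq Hqr.
  apply Rlt_div_r in Hqr; [ | lra ].
  pose proof (Rabs_pos (q - r)) as Hp.
  assert (E1 : x + alpha * q - (x + alpha * r) = alpha * (q - r)) by ring.
  assert (E2 : t + q - (t + r) = q - r) by ring.
  specialize (Hd' (x + alpha * q) (t + q) (Hpath q Hq) ltac:(lra)).
  rewrite E1, E2, Rabs_mult in Hd'.
  specialize (Hd' ltac:(nra) ltac:(nra)).
  (* The differential in the characteristic direction is [alpha * ux + ut], which the equation makes
     zero. *)
  replace (ux * (alpha * (q - r)) + ut * (q - r)) with 0 in Hd'
    by (replace ut with (- (alpha * ux)) by lra; ring).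
  rewrite Rminus_0_r in Hd'.
  eapply Rle_trans; [ exact Hd' | ].
  right. field. lra.
Qed.

Lemma transport_solution_unique (alpha : R) (u0 g : R -> R) (u : R -> R -> R) (x t : R) :
  transport_solution alpha u0 g u -> 0 <= x -> 0 <= t ->
  u x t = transport_formula alpha u0 g x t.
Proof.
  intros Hu Hx Ht. unfold transport_formula.
  destruct (Rle_dec (alpha * t) x) as [Hle | Hlt].
  - rewrite <- (transport_initial _ _ _ _ Hu) by lra.
    rewrite (transport_constant_on_characteristics _ _ _ _ (x - alpha * t) 0 t Hu) by lra.
    f_equal; ring.
  (* In this branch [0 <= x < alpha * t] forces [alpha] to be positive; the characteristic enters
     through [(0, t - x / alpha)] and takes time [x / alpha] to reach [(x, t)]. *)
  - assert (Ha : 0 < alpha) by nra.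
    assert (Hxa : 0 <= x / alpha) by (apply Rle_div_r; lra).
    assert (Htx : 0 <= t - x / alpha).
    { enough (x / alpha <= t) by lra. apply Rle_div_l; lra. }
    assert (E : alpha * (x / alpha) = x) by (field; lra).
    rewrite <- (transport_boundary _ _ _ _ Hu) by lra.
    rewrite (transport_constant_on_characteristics _ _ _ _ 0 (t - x / alpha) (x / alpha) Hu)
      by lra.
    f_equal; lra.
Qed.

(** * Functions of one linear form *)

Lemma linear_form_bound (p q a b : R) :
  Rabs (p * a + q * b) <= (Rabs p + Rabs q) * (Rabs a + Rabs b).
Proof.
  eapply Rle_trans; [ apply Rabs_triang | ]. rewrite !Rabs_mult.
  pose proof (Rabs_pos p). pose proof (Rabs_pos q).
  pose proof (Rabs_pos a). pose proof (Rabs_pos b). nra.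
Qed.

(** Chain rule for [f (p * x + q * t)]. As [f] is only controlled on the half-line, the estimate is
    confined to points where the form is nonnegative. *)
Lemma is_derive_half_line_comp_linear (f : R -> R) (p q x t l : R) :
  0 <= p * x + q * t -> is_derive_half_line f (p * x + q * t) l ->
  forall eps, 0 < eps -> exists d, 0 < d /\ forall y s, 0 <= p * y + q * s ->
    Rabs (y - x) < d -> Rabs (s - t) < d ->
    Rabs (f (p * y + q * s) - f (p * x + q * t) - (l * p * (y - x) + l * q * (s - t)))
      <= eps * (Rabs (y - x) + Rabs (s - t)).
Proof.
  intros H0 Hf eps Heps.
  pose proof (Rabs_pos p) as Hp. pose proof (Rabs_pos q) as Hq.
  (* [K] bounds the Lipschitz constant of the form in the sum norm; the added 1 keeps it positive
     when [p] and [q] vanish. *)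
  set (K := Rabs p + Rabs q + 1). assert (HK : 0 < K) by (unfold K; lra).
  destruct (is_derive_half_line_eps f _ l H0 Hf (eps / K)) as [d [Hd0 Hd]];
    [ now apply Rdiv_lt_0_compat | ].
  exists (d / (2 * K)); split; [ apply Rdiv_lt_0_compat; lra | ].
  intros y s Hys Hy Hs.
  apply Rlt_div_r in Hy; [ | lra ]. apply Rlt_div_r in Hs; [ | lra ].
  assert (E : p * y + q * s - (p * x + q * t) = p * (y - x) + q * (s - t)) by ring.
  pose proof (linear_form_bound p q (y - x) (s - t)) as Hb.
  pose proof (Rabs_pos (y - x)) as H1. pose proof (Rabs_pos (s - t)) as H2.
  assert (HbK : Rabs (p * (y - x) + q * (s - t)) <= K * (Rabs (y - x) + Rabs (s - t)))
    by (unfold K; lra).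
  specialize (Hd _ Hys). rewrite E in Hd. specialize (Hd ltac:(lra)).
  replace (l * p * (y - x) + l * q * (s - t)) with (l * (p * (y - x) + q * (s - t))) by ring.
  eapply Rle_trans; [ exact Hd | ].
  replace (eps * (Rabs (y - x) + Rabs (s - t)))
    with (eps / K * (K * (Rabs (y - x) + Rabs (s - t)))) by (field; lra).
  apply Rmult_le_compat_l; [ apply Rlt_le, Rdiv_lt_0_compat; lra | exact HbK ].
Qed.

(** Open half-planes: off the line [x = alpha * t] a single branch of the formula is in force
    nearby. The radius keeps the variation of the form below its value at [(x, t)]. *)
Lemma linear_form_pos_locally (p q x t : R) :
  0 < p * x + q * t -> exists d, 0 < d /\ forall y s,
    Rabs (y - x) < d -> Rabs (s - t) < d -> 0 < p * y + q * s.
Proof.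
  intros H0.
  pose proof (Rabs_pos p) as Hp. pose proof (Rabs_pos q) as Hq.
  set (K := Rabs p + Rabs q + 1). assert (HK : 0 < K) by (unfold K; lra).
  exists ((p * x + q * t) / (2 * K)); split; [ apply Rdiv_lt_0_compat; lra | ].
  intros y s Hy Hs.
  apply Rlt_div_r in Hy; [ | lra ]. apply Rlt_div_r in Hs; [ | lra ].
  pose proof (linear_form_bound p q (y - x) (s - t)) as Hb.
  pose proof (Rabs_pos (y - x)) as H1. pose proof (Rabs_pos (s - t)) as H2.
  assert (HbK : Rabs (p * (y - x) + q * (s - t)) <= K * (Rabs (y - x) + Rabs (s - t)))
    by (unfold K; lra).
  pose proof (Rle_abs (- (p * (y - x) + q * (s - t)))) as Hn.
  rewrite Rabs_Ropp in Hn. lra.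
Qed.

(** * The formula solves the problem *)

(** The argument keeps the shape [p * x + q * t], coefficient 1 included, so that the chain rule for
    linear forms matches it syntactically. *)
Lemma transport_formula_initial_side (alpha : R) (u0 g : R -> R) (x t : R) :
  alpha * t <= x -> transport_formula alpha u0 g x t = u0 (1 * x + - alpha * t).
Proof.
  intros H. unfold transport_formula. destruct Rle_dec; [ f_equal; ring | lra ].
Qed.

Lemma transport_formula_boundary_side (alpha : R) (u0 g : R -> R) (x t : R) :
  0 < alpha -> x < alpha * t ->
  transport_formula alpha u0 g x t = g (- / alpha * x + 1 * t).
Proof.
  intros Ha H. unfold transport_formula. destruct Rle_dec; [ lra | f_equal; field; lra ].
Qed.

Lemma boundary_form_pos (alpha x t : R) :
  0 < alpha -> x < alpha * t -> 0 < - / alpha * x + 1 * t.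
Proof.
  intros Ha H.
  replace (- / alpha * x + 1 * t) with ((alpha * t - x) / alpha) by (field; lra).
  apply Rdiv_lt_0_compat; lra.
Qed.

(** The radius [d0] covers two situations at once: points with [alpha * t < x], and all points of
    the quarter plane when [alpha <= 0]. *)
Lemma partials_initial_side (alpha : R) (u0 g : R -> R) (x t a d0 : R) :
  0 <= x -> 0 <= t -> alpha * t <= x ->
  is_derive_half_line u0 (1 * x + - alpha * t) a ->
  0 < d0 ->
  (forall y s, 0 <= y -> 0 <= s -> Rabs (y - x) < d0 -> Rabs (s - t) < d0 ->
     alpha * s <= y) ->
  is_partials (transport_formula alpha u0 g) x t (a * 1) (a * - alpha).
Proof.
  intros Hx Ht Hxt Ha Hd0 Hside.
  apply is_partials_eps; trivial. intros eps Heps.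
  destruct (is_derive_half_line_comp_linear u0 1 (- alpha) x t a ltac:(lra) Ha eps Heps)
    as [d1 [Hd1 H1]].
  exists (Rmin d0 d1); split; [ now apply Rmin_pos | ].
  pose proof (Rmin_l d0 d1). pose proof (Rmin_r d0 d1).
  intros y s Hy Hs Hyd Hsd.
  specialize (Hside y s Hy Hs ltac:(lra) ltac:(lra)).
  rewrite !transport_formula_initial_side by lra.
  apply H1; lra.
Qed.

Lemma partials_boundary_side (alpha : R) (u0 g : R -> R) (x t b : R) :
  0 < alpha -> 0 <= x -> 0 <= t -> x < alpha * t ->
  is_derive_half_line g (- / alpha * x + 1 * t) b ->
  is_partials (transport_formula alpha u0 g) x t (b * - / alpha) (b * 1).
Proof.
  intros Ha Hx Ht Hxt Hb.
  apply is_partials_eps; trivial. intros eps Heps.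
  pose proof (boundary_form_pos alpha x t Ha Hxt) as Hpos.
  (* Positivity of [- y + alpha * s] keeps nearby points on the boundary side. *)
  destruct (linear_form_pos_locally (-1) alpha x t ltac:(lra)) as [d0 [Hd0 H0]].
  destruct (is_derive_half_line_comp_linear g (- / alpha) 1 x t b ltac:(lra) Hb eps Heps)
    as [d1 [Hd1 H1]].
  exists (Rmin d0 d1); split; [ now apply Rmin_pos | ].
  pose proof (Rmin_l d0 d1). pose proof (Rmin_r d0 d1).
  intros y s Hy Hs Hyd Hsd.
  specialize (H0 y s ltac:(lra) ltac:(lra)).
  rewrite !transport_formula_boundary_side by lra.
  apply H1; try lra.
  apply Rlt_le, boundary_form_pos; lra.
Qed.

(** Both linear forms vanish on this line, so each side is estimated from the data at 0;
    [u0 0 = g 0] gives a common base value. *)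
Lemma partials_characteristic_through_corner (alpha : R) (u0 g : R -> R) (x t a b : R) :
  0 < alpha -> 0 <= x -> 0 <= t -> x = alpha * t -> u0 0 = g 0 ->
  is_derive_half_line u0 0 a -> is_derive_half_line g 0 b -> b + alpha * a = 0 ->
  is_partials (transport_formula alpha u0 g) x t (a * 1) (a * - alpha).
Proof.
  intros Hal Hx Ht Hxt H00 Ha Hb Hab.
  apply is_partials_eps; trivial. intros eps Heps.
  assert (E1 : 1 * x + - alpha * t = 0) by lra.
  assert (E2 : - / alpha * x + 1 * t = 0) by (rewrite Hxt; field; lra).
  rewrite <- E1 in Ha. rewrite <- E2 in Hb.
  destruct (is_derive_half_line_comp_linear u0 1 (- alpha) x t a ltac:(lra) Ha eps Heps)
    as [d0 [Hd0 H0]].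
  destruct (is_derive_half_line_comp_linear g (- / alpha) 1 x t b ltac:(lra) Hb eps Heps)
    as [d1 [Hd1 H1]].
  exists (Rmin d0 d1); split; [ now apply Rmin_pos | ].
  pose proof (Rmin_l d0 d1). pose proof (Rmin_r d0 d1).
  intros y s Hy Hs Hyd Hsd.
  rewrite (transport_formula_initial_side _ _ _ x t) by lra.
  destruct (Rle_dec (alpha * s) y) as [Hle | Hlt].
  - rewrite transport_formula_initial_side by lra. apply H0; lra.
  - rewrite transport_formula_boundary_side by lra.
    rewrite E1, H00, <- E2.
    (* The differential from the [u0] side is rewritten as the one from the [g] side, using
       [b = - alpha * a]. *)
    replace (a * 1) with (b * - / alpha)
      by (replace b with (- (alpha * a)) by lra; field; lra).
    replace (a * - alpha) with (b * 1) by lra.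
    apply H1; try lra.
    apply Rlt_le, boundary_form_pos; lra.
Qed.

Lemma transport_formula_solution (alpha : R) (u0 g : R -> R) :
  admissible_data alpha u0 g ->
  transport_solution alpha u0 g (transport_formula alpha u0 g).
Proof.
  intros (Hu & Hg & Hpos & Hneg). split.
  - intros x t Hx Ht.
    destruct (Rle_dec alpha 0) as [Ha | Ha].
    (* Here [alpha * s <= 0 <= y], so only the [u0] branch occurs and any radius, such as 1, will
       do. *)
    + assert (Hside : forall y s, 0 <= y -> 0 <= s -> alpha * s <= y) by (intros; nra).
      pose proof (Hside x t Hx Ht) as Hxt.
      destruct (Hu (1 * x + - alpha * t)) as [a Hda]; [ lra | ].
      exists (a * 1), (a * - alpha); split; [ | ring ].
      apply (partials_initial_side _ _ _ _ _ _ 1); auto; lra.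
    + destruct (Rtotal_order x (alpha * t)) as [Hlt | [He | Hgt]].
      * pose proof (boundary_form_pos alpha x t ltac:(lra) Hlt) as Hf.
        destruct (Hg (- / alpha * x + 1 * t)) as [b Hdb]; [ lra | ].
        exists (b * - / alpha), (b * 1); split; [ | field; lra ].
        apply partials_boundary_side; trivial; lra.
      * destruct Hpos as [H00 (a & b & Hda & Hdb & Hab)]; [ lra | ].
        exists (a * 1), (a * - alpha); split; [ | ring ].
        apply (partials_characteristic_through_corner _ _ _ _ _ _ b); trivial; lra.
      * destruct (Hu (1 * x + - alpha * t)) as [a Hda]; [ lra | ].
        destruct (linear_form_pos_locally 1 (- alpha) x t ltac:(lra)) as [d0 [Hd0 H0]].
        exists (a * 1), (a * - alpha); split; [ | ring ].
        apply (partials_initial_side _ _ _ _ _ _ d0); trivial; try lra.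
        intros y s _ _ Hy Hs. specialize (H0 y s Hy Hs). lra.
  - intros x Hx. rewrite transport_formula_initial_side by lra. f_equal; ring.
  - intros t Ht. destruct (Rle_dec alpha 0) as [Ha | Ha].
    (* For [alpha <= 0] the formula at [x = 0] reads [u0 (- alpha * t)], which admissibility equates
       with [g t]. *)
    + rewrite transport_formula_initial_side by nra. rewrite Hneg by trivial. f_equal; ring.
    + destruct Ht as [Ht | <-].
      * rewrite transport_formula_boundary_side by nra. f_equal; ring.
      (* The corner falls in the [u0] branch, so its boundary value comes from [u0 0 = g 0]. *)
      * rewrite transport_formula_initial_side by lra.
        destruct Hpos as [H00 _]; [ lra | ]. rewrite <- H00. f_equal; ring.
Qed.

Theorem corollary2p3 (alpha : R) (u0 g : R -> R) (hg : g 0 = 0) :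
  (forall u : R -> R -> R, transport_solution alpha u0 g u ->
     forall x t : R, 0 <= x -> 0 <= t ->
       u x t = transport_formula alpha u0 g x t) /\
  (admissible_data alpha u0 g ->
     transport_solution alpha u0 g (transport_formula alpha u0 g)).
Proof.
  split.
  - intros u Hu x t Hx Ht. now apply transport_solution_unique.
  - apply transport_formula_solution.
Qed.
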